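(* For every real number $\lambda>2$ there exists a substitution $\varrho$ on an infinite compact Hausdorff alphabet $\mathcal{A}$, with an associated inflation rule given by a strictly positive continuous natural length function $\ell:\mathcal{A}\to(0,\infty)$, such that the inflation factor of this inflation rule is $\lambda$, and such that every element $x$ of the subshift $X_\varrho$ gives rise to a Delone set, i.e. the set $\Lambda_x\subset\mathbb{R}$ of left endpoints of the tiles associated with $x$ via $\ell$ is a Delone set in $\mathbb{R}$.
   Context: An alphabet is a compact Hausdorff space $\mathcal{A}$; its elements are letters. $\mathcal{A}^n$ is the set of words of length $n$ with the product topology, $\mathcal{A}^+=\bigcup_{n\ge 1}\mathcal{A}^n$ carries the disjoint union topology, and $\mathcal{A}^*=\mathcal{A}^+\cup\{\text{empty word}\}$. A substitution is a continuous map $\varrho:\mathcal{A}\to\mathcal{A}^+$; it is extended to words by concatenation, so powers $\varrho^k$ make sense. A subword of a finite or bi-infinite word is a finite block of consecutive letters of it. The language $\mathcal{L}(\varrho)$ is the closure in $\mathcal{A}^*$ of the set of all subwords of the words $\varrho^k(c)$, $k\ge 0$, $c\in\mathcal{A}$. The subshift of $\varrho$ is $X_\varrho=\{x\in\mathcal{A}^{\mathbb{Z}} : \text{every finite subword of } x \text{ lies in } \mathcal{L}(\varrho)\}$, with the left shift $\sigma$, $\sigma(x)_n=x_{n+1}$. A strictly positive continuous natural length function for $\varrho$ is a continuous $\ell:\mathcal{A}\to(0,\infty)$ for which there is $\lambda>1$ with $\sum_{b\in\varrho(c)}\ell(b)=\lambda\,\ell(c)$ for all $c\in\mathcal{A}$,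 the sum being over the letters of $\varrho(c)$ counted with multiplicity. Such an $\ell$ turns $\varrho$ into an inflation rule (geometric substitution): the letter $c$ becomes an interval of length $\ell(c)$, and the interval inflated by $\lambda$ is dissected into the intervals of the letters of $\varrho(c)$, in order. The number $\lambda$ is the inflation factor. For $x\in X_\varrho$, put $p_0=0$ and $p_{n+1}=p_n+\ell(x_n)$ for all $n\in\mathbb{Z}$; the tile associated with $x_n$ is $[p_n,p_{n+1}]$, and $\Lambda_x=\{p_n:n\in\mathbb{Z}\}$. A set $\Lambda\subset\mathbb{R}^d$ is a Delone set if it is uniformly discrete (there is $r>0$ such that the balls of radius $r$ centred at the points of $\Lambda$ form a packing) and relatively dense (there is $R>0$ such that the balls of radius $R$ centred at the points of $\Lambda$ cover $\mathbb{R}^d$). *)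

(* Defs.v *)
From HB Require Import structures.
From mathcomp Require Import all_boot all_order all_algebra.
From mathcomp Require Import all_classical all_reals all_analysis.

Set Implicit Arguments.
Unset Strict Implicit.
Unset Printing Implicit Defensive.

Import Order.TTheory GRing.Theory Num.Theory.
Import numFieldNormedType.Exports.

Local Open Scope classical_set_scope.
Local Open Scope ring_scope.

(* The bijection from finite sequences over A to the disjoint union over n of
   A^n, where A^n carries the product topology. *)
Definition word_sum (A : topologicalType) (s : seq A) :
    {n : nat & {ptws 'I_n -> A}} :=
  existT (fun n => {ptws 'I_n -> A}) (size s) (tnth (in_tuple s)).

(* A^*: sequences over A with the topology transported from the disjoint union
   of the A^n along word_sum. The empty word is isolated, so A^+ is the clopen
   subspace of nonempty words. *)
Definition word (A : topologicalType) := initial_topology (@word_sum A).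

HB.instance Definition _ (A : topologicalType) := Topological.on (word A).

Lemma word_sum_bij (A : topologicalType) : bijective (@word_sum A).
Proof.
exists (fun w : {n : nat & {ptws 'I_n -> A}} =>
  codom (projT2 w : 'I_(projT1 w) -> A)) => [s|[n f]] /=.
  by rewrite codomE map_tnth_enum.
rewrite codomE /word_sum; set s := [seq f i | i <- _].
have sz : size s = n by rewrite size_map size_enum_ord.
have fE (i : 'I_(size s)) : tnth (in_tuple s) i = f (cast_ord sz i).
  have lt_in : (i < n)%N by rewrite -[X in (_ < X)%N]sz ltn_ord.
  rewrite (tnth_nth (f (cast_ord sz i))) /= (nth_map (cast_ord sz i)) ?size_enum_ord //.
  by congr f; apply: val_inj; rewrite /= nth_enum_ord.
move: (tnth (in_tuple s)) fE; move: sz; move: (size s) => m sz.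
subst m => g gE.
by congr existT; apply/funext => i; rewrite gE cast_ord_id.
Qed.

Definition substitution (A : topologicalType) (rho : A -> word A) : Prop :=
  continuous rho /\ forall c, rho c <> [::] :> seq A.

Definition subst_word (A : topologicalType) (rho : A -> word A)
    (w : word A) : word A :=
  flatten [seq (rho c : seq A) | c <- (w : seq A)].

(* infix u w: u is a block of consecutive letters of w *)
Definition language (A : topologicalType) (rho : A -> word A) : set (word A) :=
  closure [set u : word A |
    exists (k : nat) (c : A), infix u (iter k (subst_word rho) [:: c])].

(* the subword x_m x_(m+1) ... x_(m+n-1) of a bi-infinite word *)
Definition block (A : topologicalType) (x : int -> A) (m : int) (n : nat) :
    word A :=
  mkseq (fun i => x (m + i%:Z)) n.

Definition subshift (A : topologicalType) (rho : A -> word A) :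
    set (int -> A) :=
  [set x | forall (m : int) (n : nat), language rho (block x m n)].

(* ell is a strictly positive continuous natural length function for rho, and
   the resulting inflation rule has inflation factor lambda. *)
Definition natural_length (R : realType) (A : topologicalType)
    (rho : A -> word A) (ell : A -> R) (lambda : R) : Prop :=
  [/\ continuous ell, forall c, 0 < ell c, 1 < lambda &
      forall c, \sum_(b <- (rho c : seq A)) ell b = lambda * ell c].

(* Since Negz i is -(i+1), the endpoint p_(-k) for k > 0 is
   -(ell x_(-1) + ... + ell x_(-k)); see endpoint0 and endpointS. *)
Definition endpoint (R : realType) (A : Type) (ell : A -> R) (x : int -> A)
    (n : int) : R :=
  match n with
  | Posz k => \sum_(i < k) ell (x (Posz i))
  | Negz k => - \sum_(i < k.+1) ell (x (Negz i))
  end.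

Lemma endpoint0 (R : realType) (A : Type) (ell : A -> R) (x : int -> A) :
  endpoint ell x 0 = 0.
Proof. by rewrite /= big_ord0. Qed.

Lemma endpointS (R : realType) (A : Type) (ell : A -> R) (x : int -> A)
    (n : int) :
  endpoint ell x (n + 1) = endpoint ell x n + ell (x n).
Proof.
case: n => [k|[|k]].
- by rewrite -PoszD addn1 /= big_ord_recr.
- by rewrite /= big_ord0 big_ord1 addNr.
- have -> : Negz k.+1 + 1 = Negz k by rewrite !NegzE -[k.+2]addn1 PoszD opprD addrNK.
  by rewrite /= [in RHS]big_ord_recr /= opprD addrNK.
Qed.

Definition endpoint_set (R : realType) (A : Type) (ell : A -> R)
    (x : int -> A) : set R :=
  range (endpoint ell x).

Definition uniformly_discrete (R : realType) (E : normedModType R)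
    (L : set E) : Prop :=
  exists2 r : R, 0 < r & trivIset L (fun p => ball p r).

Definition relatively_dense (R : realType) (E : normedModType R)
    (L : set E) : Prop :=
  exists2 r : R, 0 < r & \bigcup_(p in L) ball p r = [set: E].

Definition delone (R : realType) (E : normedModType R) (L : set E) : Prop :=
  uniformly_discrete L /\ relatively_dense L.

(* Main.v *)
Require Import Defs.
From HB Require Import structures.
From mathcomp Require Import all_boot all_order all_algebra.
From mathcomp Require Import all_classical all_reals all_analysis.
From mathcomp Require Import ring lra zify.
Import Order.TTheory GRing.Theory Num.Theory.
Import numFieldNormedType.Exports.
Local Open Scope classical_set_scope.
Local Open Scope ring_scope.

(** The alphabet consists of all sequences [s] of positive digits at most some
    bound. A sequence has a real value, its expansion in base [lambda]:
    [ell s = \sum_k s_k / lambda ^ (k + 1)], and dropping the first digit gives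
    [lambda * ell s = s_0 + ell (shift s)]. If a letter [c] has value one, this
    equation says that the interval of length [ell s], inflated by [lambda],
    is tiled by [s_0] copies of the tile of [c] followed by the tile of
    [shift s]. So [s |-> c ... c (shift s)], with [s_0] letters [c], is a
    substitution having [ell] as a natural length function
    ([digit_subst], [expansion_rec]).

    A letter of value one exists because [lambda > 2]: iterating
    [r |-> lambda r - d] from [r = 1], where the positive digit [d] is chosen
    so that the remainder returns to [[1, 2[], expands 1 in base [lambda]
    ([exists_expansion_one]). The restriction to positive digits is what makes
    [ell] strictly positive; it also forces [lambda >= 2] for this
    construction, as the smallest expansion is then [1 / (lambda - 1)].

    The alphabet is compact by Tychonoff's theorem. The substitution is
    continuous because the length of the image of [s] depends on [s_0] only,
    and [ell] is continuous because a common prefix of length [K] brings two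
    values within a constant times [lambda ^ (- K)] ([expansion_dist]). A
    positive continuous function on a compact space is bounded away from zero
    and from infinity, so the tile lengths in any bi-infinite word yield a
    Delone set ([delone_of_compact_alphabet]). *)

(** * Delone sets from bounded tile lengths *)

Lemma endpoint_growth (R : realType) (A : Type) (ell : A -> R) (m M : R)
    (x : int -> A) (n : int) (k : nat) :
    (forall c, m <= ell c <= M) ->
  k%:R * m <= endpoint ell x (n + k%:Z) - endpoint ell x n <= k%:R * M.
Proof.
move=> ellB; elim: k => [|k IH].
  by rewrite addr0 subrr !mul0r lexx.
have -> : n + k.+1%:Z = (n + k%:Z) + 1 by rewrite -addn1 PoszD addrA.
rewrite endpointS -natr1; have := ellB (x (n + k%:Z)); lra.
Qed.

(** The successive endpoints go to both infinities with steps between [m] and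
    [M], so [m / 2] is a packing radius and [M + 1] is a covering radius. *)
Lemma delone_of_bounded_length (R : realType) (A : Type) (ell : A -> R)
    (m M : R) (x : int -> A) :
  0 < m -> (forall c, m <= ell c <= M) -> delone (endpoint_set ell x).
Proof.
move=> m0 ellB; split.
  exists (m / 2); first by rewrite divr_gt0.
  have sep (i j : int) : i < j -> m <= endpoint ell x j - endpoint ell x i.
    move=> ij; have -> : j = i + `|j - i|%N%:Z by lia.
    have /andP[+ _] := endpoint_growth _ _ _ _ _ x i `|j - i|%N ellB.
    apply: le_trans; rewrite ler_peMl ?(ltW m0)// ler1n; lia.
  move=> _ _ [i _ <-] [j _ <-] [y []].
  rewrite -!ball_normE /= => yi yj.
  have {yi yj} : `|endpoint ell x i - endpoint ell x j| < m.
    rewrite (splitr m); apply: (le_lt_trans (ler_distD y _ _)).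
    by rewrite ltrD// distrC.
  rewrite ltr_norml => /andP[lo hi].
  case: (ltgtP i j) => [/sep|/sep|-> //]; lra.
have M0 : 0 < M by have := ellB (x 0); lra.
exists (M + 1); first by rewrite ltr_wpDr.
apply/seteqP; split => // y _.
(* K steps of length at least m lead from 0 past y in either direction; the
   first endpoint beyond y, counted from index -K, then has its predecessor
   within M of y. *)
pose K : nat := Num.truncn (`|y| / m) + 1.
have Kgt : `|y| < K%:R * m.
  rewrite -ltr_pdivrMr// /K addn1.
  by case/andP: (truncn_itv (divr_ge0 (normr_ge0 y) (ltW m0))).
have [yK1 yK2] : - (K%:R * m) < y /\ y < K%:R * m.
  by move: Kgt; rewrite ltr_norml => /andP.
pose P j := y < endpoint ell x (- K%:Z + j%:Z).
have lo : endpoint ell x (- K%:Z) <= - (K%:R * m).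
  have := endpoint_growth _ _ _ _ _ x (- K%:Z) K ellB.
  rewrite addNr endpoint0; lra.
have exP : exists j, P j.
  exists (K + K)%N; rewrite /P.
  have := endpoint_growth _ _ _ _ _ x 0 K ellB.
  rewrite add0r endpoint0 PoszD addKr; lra.
case: (ex_minnP exP) => -[|j] Pj jmin.
  by move: Pj; rewrite /P addr0; lra.
exists (endpoint ell x (- K%:Z + j%:Z)); first by exists (- K%:Z + j%:Z).
have : endpoint ell x (- K%:Z + j%:Z) <= y.
  by rewrite leNgt; apply/negP => /jmin; rewrite ltnn.
move: Pj; rewrite /P.
have -> : - K%:Z + j.+1%:Z = (- K%:Z + j%:Z) + 1 by rewrite -addn1 PoszD addrA.
rewrite endpointS -ball_normE /= => h1 h2.
have := ellB (x (- K%:Z + j%:Z)) => /andP[_ h3].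
rewrite ltr_norml; apply/andP; split; lra.
Qed.

Lemma delone_of_compact_alphabet (R : realType) (A : topologicalType)
    (ell : A -> R) (x : int -> A) :
  compact [set: A] -> continuous ell -> (forall c, 0 < ell c) ->
  delone (endpoint_set ell x).
Proof.
move=> cA cell ell0.
have A0 : [set: A] !=set0 by exists (x 0).
have cw := continuous_subspaceT cell (A := [set: A]).
have [a _ amin] := compact_EVT_min A0 cA cw.
have [b _ bmax] := compact_EVT_max A0 cA cw.
apply: (@delone_of_bounded_length _ _ _ (ell a) (ell b)) => // c.
by rewrite amin ?bmax// inE.
Qed.

(** * Continuity into products and words *)

Lemma continuous_to_ptws (X V : topologicalType) (I : Type)
    (f : X -> {ptws I -> V}) :
  (forall i, continuous (fun x => f x i)) -> continuous f.
Proof.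
by move=> cf x; apply/cvg_sup => i; exact: continuous_comp_initial (cf i) x.
Qed.

Lemma continuous_ptws_eval (I : eqType) (V : topologicalType) (i : I) :
  continuous (fun s : {ptws I -> V} => s i).
Proof. exact: (@proj_continuous I (fun=> V) i). Qed.

(** Words of a fixed length form one summand of the disjoint union, so only the
    coordinates have to be continuous, and each is constant or the identity. *)
Lemma rcons_continuous (A : topologicalType) (w : seq A) :
  continuous (fun x : A => rcons w x : word A).
Proof.
apply: continuous_comp_initial.
pose g (x : A) : {ptws 'I_(size w).+1 -> A} := fun i => nth x w i.
have -> : @word_sum A \o rcons w =
    existT (fun n => {ptws 'I_n -> A}) (size w).+1 \o g.
  apply/funext => x; rewrite /= /word_sum.
  have e : size (rcons w x) = (size w).+1 by rewrite size_rcons.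
  have tE (i : 'I_(size (rcons w x))) : tnth (in_tuple (rcons w x)) i =
      g x (cast_ord e i).
    rewrite (tnth_nth x) /= /g nth_rcons; case: ltngtP => // iw.
    - by have := ltn_ord i; rewrite [X in (_ < X)%N -> _]e; lia.
    - by rewrite nth_default//= iw.
  move: (tnth _) tE; move: e; move: (size _) => n e; subst n => t tE.
  by congr existT; apply/funext => i; rewrite tE cast_ord_id.
move=> x; apply: continuous_comp; last exact: existT_continuous.
apply: continuous_to_ptws => i {}x.
have [iw|iw] := ltnP i (size w).
  have -> : (fun y => g y i) = (fun=> nth x w i).
    by apply/funext => y; exact: set_nth_default.
  exact: cvg_cst.
have -> : (fun y => g y i) = id.
  by apply/funext => y; exact: nth_default.
exact: cvg_id.
Qed.

(** * Digit sequences *)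

(** With the discrete topology on letters, this is a Cantor space if [0 < N]. *)
Definition digits (N : nat) : Type := {ptws nat -> discrete_topology 'I_N.+1}.

HB.instance Definition _ (N : nat) := Topological.on (digits N).

(** The letters of ['I_N.+1] stand for the digits [1, ..., N + 1]: the digit zero
    is excluded, so that every sequence has positive value. *)
Definition digit {N : nat} (s : digits N) (k : nat) : nat := (s k : 'I__).+1.

Lemma digit_le (N : nat) (s : digits N) (k : nat) : (digit s k <= N.+1)%N.
Proof. exact: ltn_ord. Qed.

Definition shift {N : nat} (s : digits N) : digits N := fun k => s k.+1.

Lemma digits_compact (N : nat) : compact [set: digits N].
Proof.
have -> : [set: digits N] =
    [set f | forall i, [set: discrete_topology 'I_N.+1] (f i)].
  by apply/seteqP; split.
apply: (@tychonoff nat (fun=> discrete_topology 'I_N.+1) (fun=> setT)) => i.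
exact/finite_compact/(@finite_finset 'I_N.+1).
Qed.

Lemma digits_hausdorff (N : nat) : hausdorff_space (digits N).
Proof.
apply: (@hausdorff_product nat (fun=> discrete_topology 'I_N.+1)) => i.
exact: discrete_hausdorff.
Qed.

(** The indicator sequences of single positions are pairwise distinct as soon as
    there are two letters. *)
Lemma digits_infinite (N : nat) : (0 < N)%N -> infinite_set [set: digits N].
Proof.
move=> N0 fin; apply: infinite_nat.
pose f (n : nat) : digits N := fun k => inord (k == n).
apply: (@sub_finite_set _ _ (f @^-1` setT)) => //.
apply: finite_preimage fin => m n _ _ /(congr1 (fun s => val (s m))).
by rewrite /f /= eqxx !inordK ?ltnS//; case: eqP => // ->.
Qed.

Lemma shift_continuous (N : nat) : continuous (@shift N).
Proof. by apply: continuous_to_ptws => i; exact: continuous_ptws_eval. Qed.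

Lemma near_digits_agree (N : nat) (s : digits N) (K : nat) :
  \forall t \near s, forall k, (k < K)%N -> t k = s k.
Proof.
elim: K => [|K IH]; first by near=> t.
have hK : \forall t \near s, t K = s K.
  exact: (continuous_ptws_eval _ _ K s _ (discrete_set1 (s K))).
near=> t => k; rewrite ltnS leq_eqVlt => /orP[/eqP ->|].
  by near: t.
by move: k; near: t.
Unshelve. all: by end_near. Qed.

(** * The substitution *)

(** The substitution [s |-> c ^ (s_0) (shift s)]; when [c] has value one it
    realizes [lambda * ell s = s_0 + ell (shift s)] geometrically. *)
Definition digit_subst {N : nat} (c s : digits N) : word (digits N) :=
  rcons (nseq (digit s 0) c) (shift s).

Lemma digit_subst_substitution (N : nat) (c : digits N) :
  substitution (digit_subst c).
Proof.
split => [s|s]; last by rewrite /digit_subst /= -cats1; case: (digit s 0).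
(* Near s the first digit is constant, so the prefix of c's may be fixed. *)
pose f (t : digits N) : word (digits N) := rcons (nseq (digit s 0) c) (shift t).
have cf : {for s, continuous f}.
  apply: (@continuous_comp _ _ _ shift); first exact: shift_continuous.
  exact: rcons_continuous.
move=> U Us; have nU : nbhs s (f @^-1` U) := cf U Us.
apply: filterS2 nU (near_digits_agree _ s 1) => t /= Uft agree.
by move: Uft; rewrite /f /digit_subst /digit agree.
Qed.

(** * Expansions in base lambda *)

Definition expansion {R : realType} (lambda : R) (u : nat -> nat) : R :=
  limn (series (fun k => (u k)%:R / lambda ^+ k.+1)).

Section Expansion.
Context (R : realType) (lambda : R) (N : nat) (lambda1 : 1 < lambda).

Let term (u : nat -> nat) : R^nat := fun k => (u k)%:R / lambda ^+ k.+1.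

Let lambda0 : 0 < lambda. Proof. exact: lt_trans lambda1. Qed.

Let term_ge0 u k : 0 <= term u k.
Proof. by rewrite divr_ge0 ?exprn_ge0// ltW. Qed.

Let nd u : nondecreasing_seq (series (term u)).
Proof. by apply: nondecreasing_series => k _ _; exact: term_ge0. Qed.

Lemma series_expansion_le (u : nat -> nat) (n : nat) : (forall k, (u k <= N)%N) ->
  series (term u) n <= N%:R / (lambda - 1).
Proof.
move=> uN; have q0 : 0 < lambda^-1 by rewrite invr_gt0.
have q1 : `|lambda^-1| < 1 by rewrite gtr0_norm// invf_lt1.
have Nq0 : 0 <= N%:R / lambda by rewrite divr_ge0// ltW.
have := geometric_le_lim n Nq0 q0 q1.
have -> : N%:R / lambda / (1 - lambda^-1) = N%:R / (lambda - 1).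
  by field; rewrite subr_eq0 !gt_eqF.
apply: le_trans; apply: ler_sum => k _.
by rewrite /term /= exprVn exprS invfM mulrA ler_pM2r ?invr_gt0 ?exprn_gt0//
  ler_pM2r ?invr_gt0// ler_nat.
Qed.

Lemma cvg_expansion (u : nat -> nat) : (forall k, (u k <= N)%N) ->
  series (term u) @ \oo --> expansion lambda u.
Proof.
move=> uN; apply: nondecreasing_is_cvgn; first exact: nd.
by exists (N%:R / (lambda - 1)) => _ [n _ <-]; exact: series_expansion_le.
Qed.

Lemma expansion_ge0 (u : nat -> nat) :
  (forall k, (u k <= N)%N) -> 0 <= expansion lambda u.
Proof.
move=> /cvg_expansion uc.
apply: le_trans (nondecreasing_cvgn_le (nd u) _ 0); last by apply/cvg_ex; eexists; exact: uc.
by rewrite /series /= big_geq.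
Qed.

Lemma expansion_le (u : nat -> nat) : (forall k, (u k <= N)%N) ->
  expansion lambda u <= N%:R / (lambda - 1).
Proof.
move=> uN; apply: limr_le.
  by apply/cvg_ex; eexists; exact: cvg_expansion uN.
by near=> n; exact: series_expansion_le.
Unshelve. all: by end_near. Qed.

Lemma expansion_rec (u : nat -> nat) : (forall k, (u k <= N)%N) ->
  expansion lambda u = ((u 0)%:R + expansion lambda (fun k => u k.+1)) / lambda.
Proof.
move=> uN; have /= := cvg_expansion _ uN.
rewrite -cvg_shiftS => /(cvg_lim (@Rhausdorff R)) <-.
apply: (cvg_lim (@Rhausdorff R)).
have -> : [sequence series (term u) n.+1]_n =
    (fun n => ((u 0)%:R + series (term (fun k => u k.+1)) n) / lambda).
  apply/funext => n; rewrite /series /= big_nat_recl// mulrDl; congr (_ + _).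
  rewrite mulr_suml; apply: eq_bigr => k _.
  by rewrite /term [lambda ^+ k.+2]exprSr invfM mulrA.
apply: cvgMl; apply: cvgD; first exact: cvg_cst.
by apply: cvg_expansion => k; exact: uN.
Qed.

(** Each common leading digit cancels in [expansion_rec] and contributes a factor
    [1 / lambda]; the remaining values lie in [[0, N / (lambda - 1)]]. *)
Lemma expansion_dist (u v : nat -> nat) (K : nat) :
    (forall k, (u k <= N)%N) -> (forall k, (v k <= N)%N) ->
    (forall k, (k < K)%N -> u k = v k) ->
  `|expansion lambda u - expansion lambda v| <= N%:R / (lambda - 1) / lambda ^+ K.
Proof.
elim: K u v => [|K IH] u v uN vN uv.
  rewrite expr0 divr1.
  have := expansion_ge0 _ uN; have := expansion_ge0 _ vN.
  have := expansion_le _ uN; have := expansion_le _ vN.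
  by rewrite ler_norml => *; apply/andP; split; lra.
rewrite expansion_rec// (expansion_rec v)// uv// -mulrBl opprD addrACA subrr add0r.
rewrite normrM (gtr0_norm (_ : 0 < lambda^-1)) ?invr_gt0//.
rewrite exprSr invfM [leRHS]mulrA ler_pM2r ?invr_gt0//.
by apply: IH => // k kK; exact: uv.
Qed.

End Expansion.

Lemma expansion_digit_continuous (R : realType) (lambda : R) (N : nat) :
  1 < lambda -> continuous (fun s : digits N => expansion lambda (digit s)).
Proof.
move=> l1 s.
apply: (proj2 (@cvgrPdist_lt _ _ _ (nbhs s) (nbhs_filter s) _ _)) => e e0.
pose B : R := N.+1%:R / (lambda - 1).
have q1 : `|lambda^-1| < 1 by rewrite ger0_norm ?invr_ge0 ?invf_lt1; lra.
have /cvgrPdist_lt/(_ _ e0)[K _ /(_ K (leqnn K)) /=] := cvg_geometric B q1.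
rewrite sub0r normrN exprVn => /(le_lt_trans (ler_norm _)) BK.
apply: filterS (near_digits_agree _ s K) => t agree.
apply: le_lt_trans BK; apply: expansion_dist => // [k|k|k kK].
- exact: digit_le.
- exact: digit_le.
- by rewrite /digit agree.
Qed.

(** A variant of the greedy expansion in which the remainders [r] stay in
    [[1, 2[] instead of [[0, 1[]. The next digit is the integer part of
    [lambda * r] minus one; since [lambda * r > 2] it is positive. The partial
    sums telescope to [1 - r_n / lambda ^ n]. *)
Lemma exists_expansion_one (R : realType) (lambda : R) : 2 < lambda ->
  exists u : nat -> nat,
    (forall k, (0 < u k <= Num.truncn (2 * lambda))%N) /\ expansion lambda u = 1.
Proof.
move=> l2.
pose d (r : R) := (Num.truncn (lambda * r)).-1.
pose r := fix r k : R := if k is k'.+1 then lambda * r k' - (d (r k'))%:R else 1.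
have dE (x : R) : 1 <= x < 2 ->
    [/\ (0 < d x)%N, (d x <= Num.truncn (2 * lambda))%N &
        1 <= lambda * x - (d x)%:R < 2].
  move=> /andP[x1 x2].
  have /truncn_itv/andP[] : 0 <= lambda * x by rewrite mulr_ge0//; lra.
  have lx : 2 <= lambda * x by nra.
  have t2 : (1 < Num.truncn (lambda * x))%N by rewrite truncn_ge_nat//; lra.
  rewrite /d; case: (Num.truncn (lambda * x)) t2 => // t t0 /= h1 h2.
  split => //; last by rewrite -natr1 in h1; rewrite -!natr1 in h2; lra.
  rewrite truncn_ge_nat; last by lra.
  rewrite -natr1 in h1; nra.
have rB k : 1 <= r k < 2.
  by elim: k => [|k /dE[]//]; rewrite /= lexx ltr1n.
have uB k : (0 < d (r k) <= Num.truncn (2 * lambda))%N.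
  by case: (dE _ (rB k)) => -> ->.
exists (d \o r); split => //.
have l1 : 1 < lambda by lra.
have partial n : series (fun k => (d (r k))%:R / lambda ^+ k.+1) n =
    1 - r n / lambda ^+ n.
  elim: n => [|n IH]; first by rewrite /series /= big_geq// expr0 divr1 subrr.
  rewrite seriesSr IH /= exprS.
  by field; rewrite expf_neq0 ?gt_eqF//; lra.
apply: (cvg_lim (@Rhausdorff R)).
rewrite (funext partial) -[1 in X in _ `=>` X]subr0.
apply: cvgB; first exact: cvg_cst.
have q1 : `|lambda^-1| < 1 by rewrite ger0_norm ?invr_ge0 ?invf_lt1; lra.
apply: (@squeeze_cvgr _ _ _ _ (fun=> 0) (geometric 2 lambda^-1)).
- near=> n; have /andP[r1 r2] := rB n.
  have pn : 0 <= lambda^-1 ^+ n by rewrite exprn_ge0// invr_ge0; lra.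
  by rewrite /= -exprVn; apply/andP; split; nra.
- exact: cvg_cst.
- exact: cvg_geometric.
Unshelve. all: by end_near. Qed.

(** * Inflation factor lambda *)

Theorem theorem1p1 (R : realType) (lambda : R) (hlambda : 2 < lambda) :
  exists (A : topologicalType) (rho : A -> word A) (ell : A -> R),
    [/\ [/\ infinite_set [set: A], compact [set: A] & hausdorff_space A],
        substitution rho,
        natural_length rho ell lambda &
        forall x : int -> A, subshift rho x -> delone (endpoint_set ell x)].
Proof.
have l1 : 1 < lambda by lra.
have [u [uB u1]] := exists_expansion_one _ _ hlambda.
set N := Num.truncn _ in uB.
have N0 : (0 < N)%N by have := uB 0; lia.
(* The predecessor undoes the shift between letters and digits. *)
pose c : digits N := fun k => inord (u k).-1.
have cE : digit c = u.
  apply/funext => k; rewrite /digit inordK; have := uB k; lia.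
pose ell (s : digits N) := expansion lambda (digit s).
have dB := @digit_le N.
have rec s : lambda * ell s = (digit s 0)%:R + ell (shift s).
  rewrite /ell (@expansion_rec _ _ N.+1)// mulrC divfK// gt_eqF//; lra.
have ell0 s : 0 < ell s.
  rewrite -(@pmulr_rgt0 _ lambda); last by lra.
  by rewrite rec ltr_wpDr// (@expansion_ge0 _ _ N.+1).
have c1 : ell c = 1 by rewrite /ell cE.
have cell : continuous ell by exact: expansion_digit_continuous.
exists (digits N), (digit_subst c), ell; split.
- by split; [exact: digits_infinite|exact: digits_compact|exact: digits_hausdorff].
- exact: digit_subst_substitution.
- split => // s; rewrite rec /digit_subst -cats1 big_cat big_seq1 big_nseq /=.
  by rewrite iter_addr_0 c1 /digit mulrS.
- by move=> x _; apply: delone_of_compact_alphabet => //; exact: digits_compact.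
Qed.
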